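(* Let $p=3$ and consider a lasso with normalized data. The point of tangency of the ellipsoid and the octahedron for the lasso solution cannot reach the interior of more than two different faces of the octahedron; that is, the points $\beta(t)$, $0<t<\hat t$, with all three coordinates nonzero lie in the interiors of at most two different octants of $\mathbb R^3$.
   Context: For $p=3$, a data set consists of $N$ points $(x_1^{(i)},x_2^{(i)},x_3^{(i)},y^{(i)})\in\mathbb R^{4}$ with centroid at the origin and not contained in any proper affine subspace (full rank assumption). Put $K=\frac1N\sum_i x^{(i)}(x^{(i)})^T$ (positive definite), $b=\frac1N\sum_i y^{(i)}x^{(i)}$, $\hat\beta=K^{-1}b$, $\hat t=\sum_j|\hat\beta_j|$. The data are normalized if $K_{jj}=1$ for $j=1,2,3$. For $t\ge0$ the lasso estimate $\beta(t)$ is the unique minimizer of $f(\beta)=\frac12\sum_i\big(y^{(i)}-\sum_j\beta_jx_j^{(i)}\big)^2$ over $\beta\in\mathbb R^3$ with $\sum_j|\beta_j|\le t$. For $0<t<\hat t$ it is the point of tangency of the octahedron $\{|\beta_1|+|\beta_2|+|\beta_3|=t\}$ with an ellipsoid from the homothetic family $\langle K(\beta-\hat\beta),\beta-\hat\beta\rangle=\text{const}$. As $t$ varies, a face of the octahedron is identified by its sign vector in $\{-1,1\}^3$, i.e. by the octant containing it. *)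

(* Defs.v *)
From HB Require Import structures.
From mathcomp Require Import all_boot all_order all_algebra.
From mathcomp Require Import boolp reals.

Set Implicit Arguments.
Unset Strict Implicit.
Unset Printing Implicit Defensive.

Import Order.TTheory GRing.Theory Num.Theory.
Local Open Scope ring_scope.

(* [X : 'M[R]_(N, p)] has the predictors x^(i) as its rows, and
   [y : 'cV[R]_N] holds the responses y^(i); the N data points are the rows of
   [row_mx X y : 'M[R]_(N, p + 1)]. *)

Definition centered (R : realType) (N q : nat) (Z : 'M[R]_(N, q)) : Prop :=
  \sum_(i < N) row i Z = 0.

(* An affine subspace is represented by a base point [a] and a matrix [V] whose
   row space is its direction; it is proper iff [V] is not row-full. *)
Definition full_rank_data (R : realType) (N q : nat) (Z : 'M[R]_(N, q)) : Prop :=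
  forall (a : 'rV[R]_q) (V : 'M[R]_q),
    (forall i : 'I_N, (row i Z - a <= V)%MS) -> row_full V.

Definition gram (R : realType) (N p : nat) (X : 'M[R]_(N, p)) : 'M[R]_p :=
  N%:R^-1 *: (X^T *m X).

Definition normalized (R : realType) (N p : nat) (X : 'M[R]_(N, p)) : Prop :=
  forall j : 'I_p, gram X j j = 1.

Definition xycov (R : realType) (N p : nat) (X : 'M[R]_(N, p)) (y : 'cV[R]_N)
    : 'cV[R]_p :=
  N%:R^-1 *: (X^T *m y).

Definition ols (R : realType) (N p : nat) (X : 'M[R]_(N, p)) (y : 'cV[R]_N)
    : 'cV[R]_p :=
  invmx (gram X) *m xycov X y.

Definition l1norm (R : realType) (p : nat) (v : 'cV[R]_p) : R :=
  \sum_(j < p) `|v j 0|.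

Definition loss (R : realType) (N p : nat) (X : 'M[R]_(N, p)) (y : 'cV[R]_N)
    (v : 'cV[R]_p) : R :=
  2^-1 * \sum_(i < N) (y i 0 - \sum_(j < p) v j 0 * X i j) ^+ 2.

Definition is_lasso (R : realType) (N p : nat) (X : 'M[R]_(N, p))
    (y : 'cV[R]_N) (t : R) (v : 'cV[R]_p) : Prop :=
  l1norm v <= t /\
  forall w : 'cV[R]_p, l1norm w <= t -> loss X y v <= loss X y w.

(* The interior of the orthant with sign vector ((-1)^(s j))_j. *)
Definition in_open_orthant (R : realType) (p : nat) (s : {ffun 'I_p -> bool})
    (v : 'cV[R]_p) : Prop :=
  forall j : 'I_p, 0 < (-1) ^+ s j * v j 0.

Definition reached_orthants (R : realType) (N p : nat) (X : 'M[R]_(N, p))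
    (y : 'cV[R]_N) : {set {ffun 'I_p -> bool}} :=
  [set s | `[< exists (t : R) (v : 'cV[R]_p),
               [/\ 0 < t < l1norm (ols X y), is_lasso X y t v
                 & in_open_orthant s v] >]].

(* Main.v *)
(* Let [K] be the Gram matrix and [h] the least squares estimate.  By the KKT
   conditions a lasso estimate [v] inside the orthant with signs [s] satisfies
   [K (h - v) = lam * s], [lam >= 0].  Because [K] has unit diagonal, Cramer's rule
   factors: after conjugating [K] by the signs,
     [det K * (s_j (h_j - v_j)) = lam * (1 - K_kl) (1 + K_kl - K_jl - K_jk)].
   If [s] disagrees with the sign of [h] at [j], then [1 + K_kl < K_jl + K_jk]; two
   such inequalities add up to [2 < 2 K_jk], so [s] disagrees with [h] at most once.
   Two reached orthants disagreeing at different coordinates are excluded by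
   [det K > 0].  Hence all reached sign vectors coincide off one coordinate. *)
Require Import Defs.
From mathcomp Require Import all_boot all_order all_algebra.
From mathcomp Require Import boolp reals.
From mathcomp Require Import ring lra.

Import Order.TTheory GRing.Theory Num.Theory.
Local Open Scope ring_scope.

(** * Scalar identities and inequalities in the three correlations *)

Section Scalar.
Context {R : realFieldType}.

(** Determinant of the symmetric matrix with unit diagonal and entries [r], [q], [p] in positions
    (1,2), (1,3), (2,3). *)
Definition det3 (p q r : R) := 1 + 2 * p * q * r - p ^+ 2 - q ^+ 2 - r ^+ 2.

Lemma det3C (p q r : R) : det3 p q r = det3 q p r.
Proof. by rewrite /det3; ring. Qed.

Lemma signed_solve (p q r dj dk dl ej ek el l : R) :
    ej ^+ 2 = 1 -> ek ^+ 2 = 1 -> el ^+ 2 = 1 ->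
    dj + r * dk + q * dl = l * ej ->
    r * dj + dk + p * dl = l * ek ->
    q * dj + p * dk + dl = l * el ->
  det3 p q r * (ej * dj) =
  l * ((1 - ek * el * p) *
       (1 + ek * el * p - ej * el * q - ej * ek * r)).
Proof.
move=> ej2 ek2 el2 eqj eqk eql.
(* The coefficients are the first row of the adjugate. *)
have -> : det3 p q r * (ej * dj) =
    ej * ((1 - p ^+ 2) * (dj + r * dk + q * dl)
          + (p * q - r) * (r * dj + dk + p * dl)
          + (p * r - q) * (q * dj + p * dk + dl)) by rewrite /det3; ring.
rewrite eqj eqk eql; ring: ej2 ek2 el2.
Qed.

Lemma no_two_mismatches (p q r D dj dk l : R) :
    0 < D -> 0 <= l -> p < 1 -> q < 1 -> r < 1 ->
    D * dj = l * ((1 - p) * (1 + p - q - r)) ->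
    D * dk = l * ((1 - q) * (1 + q - p - r)) ->
  dj < 0 -> dk < 0 -> False.
Proof.
move=> D0 l0 p1 q1 r1 eqj eqk dj0 dk0.
have neg (u x d : R) : u < 1 -> D * d = l * ((1 - u) * x) -> d < 0 -> x < 0.
  move=> u1 e d0; rewrite ltNge; apply/negP => x0.
  have : D * d < 0 by rewrite pmulr_rlt0.
  by rewrite e ltNge !mulr_ge0 // subr_ge0 ltW.
have := neg _ _ _ p1 eqj dj0.
have := neg _ _ _ q1 eqk dk0.
lra.
Qed.

(** In coordinates where [h] is positive, [dj], [dk] come from a point flipped at [j], and [dj'],
    [dk'] from one flipped at [k]. Multiplying the comparisons [dj' < dj] and [dk < dk'] brings out
    a common factor [l * l'] and contradicts [0 < D]. *)
Lemma no_two_flips (p q r dj dk dj' dk' l l' : R) :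
    let D := det3 p q r in
    0 < D -> 0 <= l -> 0 <= l' -> `|p| < 1 -> `|q| < 1 -> `|r| < 1 ->
    D * dj = - l * ((1 - p) * (1 + p + q + r)) ->
    D * dk = l * ((1 + q) * (1 - q + r - p)) ->
    D * dj' = l' * ((1 + p) * (1 - p + r - q)) ->
    D * dk' = - l' * ((1 - q) * (1 + q + p + r)) ->
    0 < dj -> 0 < dk' -> dj' < dj -> dk < dk' -> False.
Proof.
move=> D D0 l0 l'0; rewrite !ltr_norml.
move=> /andP[p1 p2] /andP[q1 q2] /andP[r1 r2] eqj eqk eqj' eqk' dj0 dk0 ltj ltk.
(* In these variables [D = 2 * P * Q * S - T ^+ 2], while [1 + p + q + r] is [- T] and
   [1 - p - q + r] is [T + 2 * S]. *)
pose P := 1 + p; pose Q := 1 + q; pose S := 1 + r; pose T := 2 - P - Q - S.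
have P0 : 0 < P by rewrite /P; lra.
have Q0 : 0 < Q by rewrite /Q; lra.
have S0 : 0 < S by rewrite /S; lra.
have DE : D = 2 * P * Q * S - T ^+ 2 by rewrite /D /det3 /T /P /Q /S; ring.
have {}eqj : D * dj = l * ((2 - P) * T) by rewrite eqj /T /P /Q /S; ring.
have {}eqk' : D * dk' = l' * ((2 - Q) * T) by rewrite eqk' /T /P /Q /S; ring.
have {}eqk : D * dk = l * (Q * (T + 2 * S)) by rewrite eqk /T /P /Q /S; ring.
have {}eqj' : D * dj' = l' * (P * (T + 2 * S)) by rewrite eqj' /T /P /Q /S; ring.
have P2 : 0 < 2 - P by rewrite /P; lra.
have Q2 : 0 < 2 - Q by rewrite /Q; lra.
have pos (m u d : R) : 0 <= m -> 0 < u -> 0 < d -> D * d = m * (u * T) -> 0 < T.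
  move=> m0 u0 d0 e; rewrite ltNge; apply/negP => T0.
  have : 0 < D * d by rewrite mulr_gt0.
  by rewrite e ltNge mulr_ge0_le0 // mulr_ge0_le0 // ltW.
have T0 : 0 < T by apply: pos eqj.
have W0 : 0 < T + 2 * S by lra.
have posl (m u d : R) : 0 <= m -> 0 < d -> D * d = m * u -> 0 < m.
  move=> m0 d0 e; rewrite lt_neqAle m0 andbT; apply/eqP => m00.
  have : 0 < D * d by rewrite mulr_gt0.
  by rewrite e -m00 mul0r ltxx.
have {}l0 : 0 < l by apply: posl eqj.
have {}l'0 : 0 < l' by apply: posl eqk'.
have ltj' : l' * (P * (T + 2 * S)) < l * ((2 - P) * T) by rewrite -eqj -eqj' ltr_pM2l.
have ltk' : l * (Q * (T + 2 * S)) < l' * ((2 - Q) * T) by rewrite -eqk -eqk' ltr_pM2l.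
have : (l' * (P * (T + 2 * S))) * (l * (Q * (T + 2 * S)))
     < (l * ((2 - P) * T)) * (l' * ((2 - Q) * T)).
  by apply: ltr_pM => //; rewrite ltW // !mulr_gt0.
(* [T ^+ 2 = 2 * P * Q * S - D] makes the difference of the two sides
   [- 2 * l * l' * D * (T + S)], so the strict inequality is impossible. *)
have -> : l * ((2 - P) * T) * (l' * ((2 - Q) * T)) =
  (l' * (P * (T + 2 * S))) * (l * (Q * (T + 2 * S)))
  - l * l' * (2 * D * (T + S)) by rewrite DE /T; ring.
have := mulr_gt0 (mulr_gt0 l0 l'0) (mulr_gt0 D0 (addr_gt0 T0 S0)).
lra.
Qed.

End Scalar.

(** * The Gram matrix: symmetry, positive definiteness, invertibility *)

Section Gram.
Context {R : realType} {N p : nat}.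
Implicit Types (X : 'M[R]_(N, p)) (y : 'cV[R]_N) (v z : 'cV[R]_p).

Lemma gram_sym X : (gram X)^T = gram X.
Proof. by rewrite /gram linearZ /= trmx_mul trmxK. Qed.

(** Otherwise all data rows would lie in the hyperplane through the origin orthogonal to [z] padded
    with a zero response entry. *)
Lemma full_rank_inj X y z :
  full_rank_data (row_mx X y) -> X *m z = 0 -> z = 0.
Proof.
move=> hfull Xz0; pose w : 'cV[R]_(p + 1) := col_mx z 0.
have rows (i : 'I_N) : (row i (row_mx X y) - 0 <= kermx w)%MS.
  apply/sub_kermxP; rewrite subr0 -row_mul mul_row_col Xz0 mulmx0 addr0.
  exact: raddf0.
have /row_fullP[B Bk] := hfull _ _ rows.
have w0 : w = 0 by rewrite -[w]mul1mx -Bk -mulmxA mulmx_ker mulmx0.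
by rewrite -(col_mxKu z (0 : 'cV_1)) -/w w0 linear0.
Qed.

Lemma gram_form X z :
  \sum_j z j 0 * (gram X *m z) j 0 = N%:R^-1 * \sum_i (X *m z) i 0 ^+ 2.
Proof.
have -> : \sum_j z j 0 * (gram X *m z) j 0 = (z^T *m (gram X *m z)) 0 0.
  by rewrite [RHS]mxE; apply: eq_bigr => j _; rewrite [z^T 0 j]mxE.
rewrite /gram -scalemxAl -scalemxAr -[X^T *m X *m z]mulmxA [z^T *m _]mulmxA.
rewrite -trmx_mul mxE; congr (_ * _).
by rewrite mxE; apply: eq_bigr => i _; rewrite [_^T 0 i]mxE expr2.
Qed.

Lemma gram_posdef X y z : (0 < N)%N -> full_rank_data (row_mx X y) ->
  z != 0 -> 0 < \sum_j z j 0 * (gram X *m z) j 0.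
Proof.
move=> N0 hfull z0; rewrite gram_form mulr_gt0 ?invr_gt0 ?ltr0n //.
rewrite lt_neqAle sumr_ge0 => [|i _]; last exact: sqr_ge0.
rewrite andbT eq_sym; apply: contraNneq z0 => /eqP.
rewrite psumr_eq0 => [/allP Xz0|i _]; last exact: sqr_ge0.
apply/eqP/(full_rank_inj X y) => //.
apply/matrixP => i j; rewrite ord1 [RHS]mxE.
by apply/eqP; rewrite -sqrf_eq0; apply: Xz0; rewrite mem_index_enum.
Qed.

Lemma gram_unit X y : (0 < N)%N -> full_rank_data (row_mx X y) ->
  gram X \in unitmx.
Proof.
move=> N0 hfull; rewrite unitmxE unitfE; apply/negP => /det0P[u u0 uK].
have ut0 : u^T != 0 by rewrite -(inj_eq trmx_inj) trmxK trmx0.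
have := gram_posdef X y u^T N0 hfull ut0.
rewrite -gram_sym -trmx_mul uK trmx0 big1 ?ltxx // => j _.
by rewrite [X in _ * X]mxE mulr0.
Qed.

(** * First-order optimality of the lasso inside an orthant *)

Lemma lossE X y v : loss X y v = 2^-1 * \sum_i (y - X *m v) i 0 ^+ 2.
Proof.
congr (_ * _); apply: eq_bigr => i _; congr (_ ^+ 2); rewrite !mxE.
by congr (_ - _); apply: eq_bigr => j _; rewrite mulrC.
Qed.

Lemma loss_line X y v z (e : R) :
  loss X y (v + e *: z) = loss X y v
    - e * \sum_j (X^T *m (y - X *m v)) j 0 * z j 0
    + e ^+ 2 * (2^-1 * \sum_i (X *m z) i 0 ^+ 2).
Proof.
have -> : \sum_j (X^T *m (y - X *m v)) j 0 * z j 0 =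
          \sum_i (y - X *m v) i 0 * (X *m z) i 0.
  transitivity (((y - X *m v)^T *m (X *m z)) 0 0).
    rewrite mulmxA -[_ *m X]trmxK trmx_mul trmxK [RHS]mxE.
    by apply: eq_bigr => j _; rewrite [in RHS]mxE.
  by rewrite mxE; apply: eq_bigr => i _; rewrite mxE.
rewrite !lossE !mulr_sumr -sumrB -big_split /=; apply: eq_bigr => i _.
rewrite mulmxDr -scalemxAr opprD addrA.
move: (y - X *m v) (X *m z) => r x; rewrite !mxE; by field.
Qed.

Lemma l1norm_orthant (s : {ffun 'I_p -> bool}) v :
  (forall j, 0 <= (-1) ^+ s j * v j 0) ->
  l1norm v = \sum_j (-1) ^+ s j * v j 0.
Proof.
move=> sv; apply: eq_bigr => j _.
by rewrite -(normrMsign (s j)) ger0_norm.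
Qed.

(** Near [v] the l1 norm is linear with gradient [s], so a short step along [z] stays feasible and
    cannot lower the loss to first order. *)
Lemma lasso_descent X y (t : R) v (s : {ffun 'I_p -> bool}) z :
    is_lasso X y t v -> in_open_orthant s v ->
    \sum_j (-1) ^+ s j * z j 0 <= 0 ->
  \sum_j (X^T *m (y - X *m v)) j 0 * z j 0 <= 0.
Proof.
move=> [vt vmin] sv sz; set a := \sum_j _ * z j 0; rewrite leNgt; apply/negP => a0.
set E := 2^-1 * \sum_i (X *m z) i 0 ^+ 2.
have E0 : 0 <= E by rewrite mulr_ge0 ?invr_ge0 ?ler0n ?sumr_ge0 // => i _; exact: sqr_ge0.
(* The ratios over [j] keep [v + m *: z] in the closed orthant; the bound [a / (1 + E)] makes the
   change of loss at most [- m ^+ 2]. *)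
pose m := \big[Order.min/(a / (1 + E))]_j ((-1) ^+ s j * v j 0 / (1 + `|z j 0|)).
have m0 : 0 < m.
  apply: lt_bigmin => [|j _]; first by rewrite divr_gt0 // ltr_wpDr.
  by rewrite divr_gt0 // ltr_wpDr // normr_ge0.
have sw j : 0 <= (-1) ^+ s j * (v + m *: z) j 0.
  rewrite !mxE mulrDr mulrCA.
  have : m <= (-1) ^+ s j * v j 0 / (1 + `|z j 0|) by apply: bigmin_le.
  rewrite ler_pdivlMr ?ltr_wpDr ?normr_ge0 // => mz.
  have : - (m * `|z j 0|) <= m * ((-1) ^+ s j * z j 0).
    rewrite -mulrN ler_pM2l // -(normrMsign (s j)); exact: lerNnormlW.
  by move: mz; rewrite mulrDr mulr1; lra.
have wt : l1norm (v + m *: z) <= t.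
  apply: le_trans vt; rewrite (l1norm_orthant s) // (l1norm_orthant s v); last first.
    by move=> j; rewrite ltW.
  have -> : \sum_j (-1) ^+ s j * (v + m *: z) j 0 =
      \sum_j (-1) ^+ s j * v j 0 + m * \sum_j (-1) ^+ s j * z j 0.
    rewrite mulr_sumr -big_split /=; apply: eq_bigr => j _.
    by rewrite !mxE mulrDr mulrCA.
  by rewrite gerDl pmulr_rle0.
have := vmin _ wt; rewrite loss_line -/a -/E.
have : m <= a / (1 + E) by apply: bigmin_le_id.
rewrite ler_pdivlMr ?ltr_wpDr // => mE.
have : m * (m * (1 + E)) <= m * a by rewrite ler_pM2l.
have := mulr_gt0 m0 m0; lra.
Qed.

(** Shrinking one coordinate shows that the signed entries of the negative gradient are nonnegative;
    trading mass between two coordinates, in both directions, shows that they are equal. *)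
Lemma lasso_kkt X y (t : R) v (s : {ffun 'I_p -> bool}) :
    is_lasso X y t v -> in_open_orthant s v ->
  exists2 l : R, 0 <= l &
    forall j, (xycov X y - gram X *m v) j 0 = l * (-1) ^+ s j.
Proof.
move=> hv sv; pose g := X^T *m (y - X *m v).
have gE j : (xycov X y - gram X *m v) j 0 = N%:R^-1 * g j 0.
  by rewrite /g mulmxBr mulmxA /xycov /gram -scalemxAl -scalerBr mxE.
have sumd (f : 'I_p -> R) k : \sum_j f j * (delta_mx k 0 : 'cV[R]_p) j 0 = f k.
  rewrite (bigD1 k) //= mxE !eqxx mulr1 big1 ?addr0 // => j jk.
  by rewrite mxE (negbTE jk) mulr0.
have sg2 j : (-1) ^+ s j * (-1) ^+ s j = 1 :> R by rewrite -expr2 sqrr_sign.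
have g0 j : 0 <= (-1) ^+ s j * g j 0.
  have := lasso_descent X y t v s (- (-1) ^+ s j *: delta_mx j 0) hv sv.
  have F (f : 'I_p -> R) : \sum_i f i * (- (-1) ^+ s j *: delta_mx j 0 : 'cV[R]_p) i 0
      = - ((-1) ^+ s j * f j).
    rewrite -[in RHS](sumd f) mulr_sumr -sumrN; apply: eq_bigr => i _.
    by rewrite !mxE; ring.
  by rewrite !F sg2 -/g oppr_le0 ler01 => /(_ isT); rewrite oppr_le0.
have gle j k : (-1) ^+ s j * g j 0 <= (-1) ^+ s k * g k 0.
  have := lasso_descent X y t v s
    ((-1) ^+ s j *: delta_mx j 0 - (-1) ^+ s k *: delta_mx k 0) hv sv.
  have F (f : 'I_p -> R) : \sum_i f i *
      ((-1) ^+ s j *: delta_mx j 0 - (-1) ^+ s k *: delta_mx k 0 : 'cV[R]_p) i 0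
      = (-1) ^+ s j * f j - (-1) ^+ s k * f k.
    rewrite -[in RHS](sumd f j) -[in RHS](sumd f k) !mulr_sumr -sumrB.
    by apply: eq_bigr => i _; rewrite !mxE; ring.
  by rewrite !F !sg2 -/g subrr lexx => /(_ isT); rewrite subr_le0.
(* For [p = 0] there is no coordinate to read the multiplier from, and [0] serves. *)
case: (pickP 'I_p) => [k _|no]; last by exists 0 => // j; have := no j.
exists (N%:R^-1 * ((-1) ^+ s k * g k 0)) => [|j].
  by rewrite mulr_ge0 // invr_ge0 ler0n.
rewrite gE -mulrA; congr (_ * _).
have -> : (-1) ^+ s k * g k 0 = (-1) ^+ s j * g j 0 by apply/le_anti; rewrite !gle.
by rewrite mulrAC sg2 mul1r.
Qed.

End Gram.

(** * Correlation matrices of size three, in coordinates *)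

Section ThreePredictors.
Context {R : realType}.
Variable K : 'M[R]_3.
Hypothesis Ksym : K^T = K.
Hypothesis Kdiag : forall j, K j j = 1.
Hypothesis Kpos :
  forall z : 'cV[R]_3, z != 0 -> 0 < \sum_j z j 0 * (K *m z) j 0.
Variable h : 'cV[R]_3.

Let KC i j : K i j = K j i.
Proof. by rewrite -[in LHS]Ksym mxE. Qed.

(** Carrying the sum rule lets each computation run for any labelling of the coordinates, with no
    case split on ['I_3]. *)
Definition enumerates (j k l : 'I_3) :=
  [/\ j != k, j != l, k != l & forall F : 'I_3 -> R, \sum_i F i = F j + F k + F l].

Lemma third_index (j k : 'I_3) : j != k -> exists l, enumerates j k l.
Proof.
move=> jk; have /eqP/cards1P[l El] : #|~: [set j; k]| = 1%N.
  by apply/eqP; rewrite -(eqn_add2l #|[set j; k]|) cardsC cards2 jk card_ord.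
have lE i : (i != j) && (i != k) = (i == l).
  by have := in_set1 i l; rewrite -El !inE negb_or.
have /andP[lj lk] : (l != j) && (l != k) by rewrite lE.
exists l; split => [|||F] //; rewrite ?[_ == l]eq_sym //.
rewrite (bigD1 j) //= (bigD1 k) /=; last by rewrite eq_sym.
by rewrite addrA (big_pred1 l).
Qed.

Lemma enumerates_rot j k l : enumerates j k l -> enumerates l j k.
Proof.
by case=> jk jl kl F; split=> [|||G]; rewrite ?[l == _]eq_sym // F addrC addrA.
Qed.

Lemma enumerates_swap j k l : enumerates j k l -> enumerates k j l.
Proof.
case=> jk jl kl F; split=> // [|G]; first by rewrite eq_sym.
by rewrite F [G j + _]addrC.
Qed.

Lemma form3_gt0 j k l (a b c : R) : enumerates j k l ->
    [|| a != 0, b != 0 | c != 0] ->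
  0 < a ^+ 2 + b ^+ 2 + c ^+ 2
      + 2 * (K j k * a * b + K j l * a * c + K k l * b * c).
Proof.
case=> jk jl kl sum3 abc.
pose z : 'cV[R]_3 := \col_i (if i == j then a else if i == k then b else c).
have zj : z j 0 = a by rewrite mxE eqxx.
have zk : z k 0 = b by rewrite mxE eq_sym (negbTE jk) eqxx.
have zl : z l 0 = c by rewrite mxE eq_sym (negbTE jl) eq_sym (negbTE kl).
have z0 : z != 0.
  by apply: contraL abc => /eqP z0; rewrite -zj -zk -zl z0 !mxE eqxx.
have := Kpos z z0; rewrite sum3 ![(K *m z) _ _]mxE !sum3 zj zk zl !Kdiag.
rewrite (KC k j) (KC l j) (KC l k).
by congr (_ < _); ring.
Qed.

(** On the vectors [(1, 1, 0)] and [(1, -1, 0)] the form takes the values [2 + 2 * K j k] and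
    [2 - 2 * K j k]. *)
Lemma corr_lt1 j k l : enumerates j k l -> `|K j k| < 1.
Proof.
move=> jkl; have := form3_gt0 j k l 1 1 0 jkl; have := form3_gt0 j k l 1 (-1) 0 jkl.
rewrite oner_eq0 => /(_ isT) + /(_ isT).
by rewrite ltr_norml => *; apply/andP; split; lra.
Qed.

Lemma det3_gt0 j k l : enumerates j k l -> 0 < det3 (K k l) (K j l) (K j k).
Proof.
move=> jkl; have := corr_lt1 j k l jkl.
move: (form3_gt0 j k l (K k l * K j k - K j l) (K j l * K j k - K k l)
         (1 - K j k ^+ 2) jkl).
set p := K k l; set q := K j l; set r := K j k => form r1.
have r2 : 0 < 1 - r ^+ 2.
  move: r1; rewrite ltr_norml => /andP[r1 r1'].
  have -> : 1 - r ^+ 2 = (1 - r) * (1 + r) by ring.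
  by apply: mulr_gt0; lra.
(* The test vector is the third column of the adjugate, on which the form takes
   the value [(1 - r ^+ 2) * det3 p q r]. *)
have := form; rewrite (gt_eqF r2) !orbT => /(_ isT).
rewrite -[0 < det3 _ _ _](pmulr_rgt0 _ r2) /det3; congr (_ < _); ring.
Qed.

(** * Points inside a face and their sign mismatches with [h] *)

Definition face_point (s : {ffun 'I_3 -> bool}) (v : 'cV[R]_3) (lam : R) : Prop :=
  [/\ in_open_orthant s v, 0 <= lam &
      forall j, (K *m (h - v)) j 0 = lam * (-1) ^+ s j].

Lemma face_solve s v lam j k l : face_point s v lam -> enumerates j k l ->
  let e i : R := (-1) ^+ s i in
  det3 (K k l) (K j l) (K j k) * (e j * (h j 0 - v j 0)) =
  lam * ((1 - e k * e l * K k l) *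
    (1 + e k * e l * K k l - e j * e l * K j l - e j * e k * K j k)).
Proof.
move=> [_ _ eqs] [_ _ _ sum3] e; pose d := h - v.
have dE i : h i 0 - v i 0 = d i 0 by rewrite !mxE.
have row i := eqs i; have sg i : e i ^+ 2 = 1 by rewrite sqrr_sign.
rewrite dE; apply: (@signed_solve _ _ _ _ _ (d k 0) (d l 0)) => //.
- by have := row j; rewrite mxE sum3 Kdiag mul1r.
- by have := row k; rewrite mxE sum3 Kdiag mul1r (KC k j).
- by have := row l; rewrite mxE sum3 Kdiag mul1r (KC l j) (KC l k).
Qed.

(** A zero entry of [h] mismatches either sign, so the absence of a mismatch determines [s j]. *)
Definition mismatch (s : {ffun 'I_3 -> bool}) j := (-1) ^+ s j * h j 0 <= 0.

Lemma mismatch_uniq s v lam j k :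
  face_point s v lam -> mismatch s j -> mismatch s k -> j = k.
Proof.
move=> fp mj mk; apply/eqP; apply/negPn/negP => jk.
have [l jkl] := third_index j k jk.
have kjl := enumerates_swap j k l jkl.
have := face_solve s v lam j k l fp jkl; have := face_solve s v lam k j l fp kjl.
rewrite (KC k j); have [sv lam0 _] := fp; have D0 := det3_gt0 j k l jkl.
have := corr_lt1 j k l jkl; have := corr_lt1 _ _ _ (enumerates_rot _ _ _ jkl).
have := corr_lt1 _ _ _ (enumerates_rot _ _ _ kjl).
rewrite (KC l j) (KC l k).
have corr (b c : bool) (x : R) : `|x| < 1 -> (-1) ^+ b * (-1) ^+ c * x < 1.
  move=> x1; rewrite -signr_addb; apply: le_lt_trans (ler_norm _) _.
  by rewrite normrMsign.
move=> /(corr (s k) (s l)) p1 /(corr (s j) (s l)) q1 /(corr (s j) (s k)) r1 /= eqk eqj.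
apply: (no_two_mismatches _ _ _ _ _ _ _ D0 lam0 p1 q1 r1 eqj).
- by rewrite (mulrC (_ ^+ s j) (_ ^+ s k)) -eqk det3C.
- by have := sv j; move: mj; rewrite /mismatch mulrBr; lra.
- by have := sv k; move: mk; rewrite /mismatch mulrBr; lra.
Qed.

Lemma signr_inj_gt0 (b c : bool) (x : R) :
  0 < (-1) ^+ b * x -> 0 < (-1) ^+ c * x -> b = c.
Proof. by case: b; case: c; rewrite ?expr1 ?expr0 //; lra. Qed.

Lemma signr_opp_gt0 (b c : bool) (x : R) :
  (-1) ^+ b * x <= 0 -> 0 < (-1) ^+ c * x -> (-1) ^+ b = - (-1) ^+ c :> R.
Proof. by case: b; case: c; rewrite ?expr1 ?expr0 ?opprK //; lra. Qed.

(** If [j != k], then [mismatch_uniq], applied to each point, forces all other signs to be those of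
    [h], which is the configuration excluded by [no_two_flips]. *)
Lemma mismatch_uniq2 s s' v v' lam lam' j k :
    face_point s v lam -> face_point s' v' lam' ->
  mismatch s j -> mismatch s' k -> j = k.
Proof.
move=> fp fp' mj mk; apply/eqP; apply/negPn/negP => jk.
have [l jkl] := third_index j k jk; have [_ jl kl _] := jkl.
have match_ne t w m i i' : face_point t w m -> mismatch t i -> i != i' ->
    0 < (-1) ^+ t i' * h i' 0.
  move=> ft mi ii'; rewrite ltNge; apply: contra ii' => mi'.
  by apply/eqP/(mismatch_uniq t w m).
have kjl := enumerates_swap j k l jkl.
have jk' : k != j by rewrite eq_sym.
have ejE := signr_opp_gt0 _ _ _ mj (match_ne _ _ _ _ _ fp' mk jk').
have ekE := signr_opp_gt0 _ _ _ mk (match_ne _ _ _ _ _ fp mj jk).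
have elE := signr_inj_gt0 _ _ _ (match_ne _ _ _ _ _ fp mj jl)
  (match_ne _ _ _ _ _ fp' mk kl).
have hj := match_ne _ _ _ _ _ fp' mk jk'; have hk := match_ne _ _ _ _ _ fp mj jk.
have := (face_solve s v lam j k l fp jkl, face_solve s v lam k j l fp kjl,
         face_solve s' v' lam' j k l fp' jkl, face_solve s' v' lam' k j l fp' kjl).
rewrite (KC k j) /= => -[[[eqj eqk] eqj'] eqk'].
have [sv lam0 _] := fp; have [sv' lam0' _] := fp'.
have [svj svk svj' svk'] := And4 (sv j) (sv k) (sv' j) (sv' k).
have D0 := det3_gt0 j k l jkl.
have r1 := corr_lt1 j k l jkl; have q1 := corr_lt1 _ _ _ (enumerates_rot _ _ _ jkl).
have p1 := corr_lt1 _ _ _ (enumerates_rot _ _ _ kjl).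
move: mj mk eqj eqk eqj' eqk' svj svk svj' svk'.
rewrite /mismatch -elE; move: q1 p1; rewrite (KC l j) (KC l k) => q1 p1.
move: ejE ekE hj hk.
(* [tj, tk, tl] are the signs of [h]; conjugated by them, [s] becomes [(-1, 1, 1)]
   and [s'] becomes [(1, -1, 1)]. *)
set tj : R := (-1) ^+ s' j; set tk : R := (-1) ^+ s k; set tl : R := (-1) ^+ s l.
move=> -> -> hj hk mj mk eqj eqk eqj' eqk' svj svk svj' svk'.
have [tj2 tk2 tl2] : [/\ tj ^+ 2 = 1, tk ^+ 2 = 1 & tl ^+ 2 = 1].
  by split; rewrite sqrr_sign.
have norm1 (b c : bool) (x : R) : `|x| < 1 -> `|(-1) ^+ b * (-1) ^+ c * x| < 1.
  by rewrite -signr_addb normrMsign.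
pose p := tk * tl * K k l; pose q := tj * tl * K j l; pose r := tj * tk * K j k.
have DE : det3 p q r = det3 (K k l) (K j l) (K j k).
  by rewrite /det3 /p /q /r; ring: tj2 tk2 tl2.
apply: (no_two_flips p q r (tj * (h j 0 - v j 0)) (tk * (h k 0 - v k 0))
  (tj * (h j 0 - v' j 0)) (tk * (h k 0 - v' k 0)) lam lam'); rewrite ?DE //.
- exact: norm1.
- exact: norm1.
- exact: norm1.
- by apply: oppr_inj; rewrite -mulrN -mulNr eqj /p /q /r; ring.
- by rewrite det3C eqk /p /q /r; ring.
- by rewrite eqj' /p /q /r; ring.
- by apply: oppr_inj; rewrite det3C -mulrN -mulNr eqk' /p /q /r; ring.
- by rewrite mulrBr; lra.
- by rewrite mulrBr; lra.
- by rewrite !mulrBr; lra.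
- by rewrite !mulrBr; lra.
Qed.

Lemma card_face_le2 (A : {set {ffun 'I_3 -> bool}}) :
    (forall s, s \in A -> exists v lam, face_point s v lam) ->
  (#|A| <= 2)%N.
Proof.
move=> hA.
(* All mismatches in [A] share one coordinate [j]; if there are none, any [j] will do. *)
have [j jP] : exists j, forall s, s \in A ->
    forall k, k != j -> 0 < (-1) ^+ s k * h k 0.
  case: (boolP [exists s in A, [exists j, mismatch s j]]) => [|none].
    move=> /exists_inP[s sA /existsP[j mj]]; exists j => s' s'A k kj.
    rewrite ltNge; apply: contra kj => mk; apply/eqP.
    have [[v [lam fp]] [v' [lam' fp']]] := (hA s sA, hA s' s'A).
    exact: (mismatch_uniq2 s' s v' v lam' lam).
  exists 0 => s sA k _; rewrite ltNge; apply: contra none => mk.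
  by apply/exists_inP; exists s => //; apply/existsP; exists k.
(* Off [j] every sign is that of [h], so [A] embeds into [bool]. *)
have inj : {in A &, injective (fun s : {ffun 'I_3 -> bool} => s j)}.
  move=> s s' sA s'A eqj; apply/ffunP => k; have [->//|kj] := eqVneq k j.
  exact: signr_inj_gt0 (jP s sA k kj) (jP s' s'A k kj).
by rewrite -(card_in_imset inj) (leq_trans (max_card _)) ?card_bool.
Qed.

End ThreePredictors.

Theorem theorem4p4 (R : realType) (N : nat) (X : 'M[R]_(N, 3)) (y : 'cV[R]_N)
    (hcentered : centered (row_mx X y))
    (hfull : full_rank_data (row_mx X y))
    (hnormalized : normalized X) :
  (#|reached_orthants X y| <= 2)%N.
Proof.
(* For [N = 0] the convention [0^-1 = 0] makes the Gram matrix zero, against its unit diagonal. *)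
have N0 : (0 < N)%N.
  rewrite lt0n; apply/eqP => N0; have := hnormalized 0.
  have NR0 : N%:R = 0 :> R by rewrite N0.
  by rewrite /gram NR0 invr0 scale0r mxE => /esym/eqP; rewrite oner_eq0.
apply: (card_face_le2 (gram X) (gram_sym X) hnormalized _ (ols X y)).
  by move=> z; apply: gram_posdef N0 hfull.
move=> s; rewrite inE => /asboolP[t [v [_ hv sv]]].
have [lam lam0 kkt] := lasso_kkt X y t v s hv sv.
exists v, lam; split=> // j.
by rewrite mulmxBr /ols mulKVmx ?(gram_unit X y) // kkt.
Qed.
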